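(* Let $\mathbf{G}=(\mathbf{A},\forall,\exists)$ be a monadic Gödel algebra and $\mathbf{K}(\mathbf{G})$ its associated monadic $N_c$-algebra. Then the map $f:Con(\mathbf{G})\to Con(\mathbf{K}(\mathbf{G}))$, $f(\theta)=\gamma_\theta$, where $(a,b)\,\gamma_\theta\,(x,y)$ iff $(a,x)\in\theta$ and $(b,y)\in\theta$, is an order isomorphism.
   Context: $Con(\mathbf{B})$ denotes the lattice of congruences of an algebra $\mathbf{B}$, ordered by inclusion. A Heyting algebra is $\langle A,\vee,\wedge,\Rightarrow,0,1\rangle$ with bounded lattice reduct satisfying $x\wedge(x\Rightarrow y)=x\wedge y$, $x\wedge(y\Rightarrow z)=x\wedge((x\wedge y)\Rightarrow(x\wedge z))$, $(x\wedge y)\Rightarrow x=1$. A monadic Heyting algebra is $(\mathbf{A},\forall,\exists)$ with unary operations satisfying $\forall x\leq x$, $x\leq\exists x$, $\forall(x\wedge y)=\forall x\wedge\forall y$, $\exists(x\vee y)=\exists x\vee\exists y$, $\forall 1=1$, $\exists 0=0$, $\forall\exists x=\exists x$, $\exists\forall x=\forall x$, $\forall(x\Rightarrow y)\leq\exists x\Rightarrow\exists y$. A monadic Gödel algebra is a monadic Heyting algebra satisfying $(x\Rightarrow y)\vee(y\Rightarrow x)=1$ and $\forall(\exists x\vee y)=\exists x\vee\forall y$; its congruences are those compatible with $\vee,\wedge,\Rightarrow,\forall,\exists$. $\mathbf{K}(\mathbf{G})$ is the algebra on $K(A)=\{(a,b)\in A\times A:a\wedge b=0\}$ with $(a,b)\vee(d,e)=(a\vee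 d,b\wedge e)$, $(a,b)\wedge(d,e)=(a\wedge d,b\vee e)$, $(a,b)\to(d,e)=(a\Rightarrow d,a\wedge e)$, $\sim(a,b)=(b,a)$, constants $0=(0,1)$, $1=(1,0)$, and $\exists_K(a,b)=(\exists a,\forall b)$; its congruences are those compatible with $\vee,\wedge,\to,\sim,\exists_K$. *)

(* Defs.v *)
From HB Require Import structures.
From mathcomp Require Import all_boot all_order.
From mathcomp Require Import boolp classical_sets.

Set Implicit Arguments.
Unset Strict Implicit.
Unset Printing Implicit Defensive.

Import Order.TTheory.
Local Open Scope order_scope.

Record algebra := Algebra {
  carrier :> Type;
  symbol : Type;
  arity : symbol -> nat;
  interp : forall s : symbol, ('I_(arity s) -> carrier) -> carrier }.

(* A binary relation on B is the set of its pairs, as an element of           *)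
(* set (B * B), so that the order of the library on sets is inclusion.        *)
Record congruence (B : algebra) (theta : set (B * B)) : Prop := Congruence {
  cong_refl : forall x, theta (x, x);
  cong_sym : forall x y, theta (x, y) -> theta (y, x);
  cong_trans : forall y x z, theta (x, y) -> theta (y, z) -> theta (x, z);
  cong_compat : forall (s : symbol B) (u v : 'I_(arity s) -> B),
    (forall i, theta (u i, v i)) -> theta (interp u, interp v) }.

Record Con (B : algebra) := MkCon {
  con_rel :> set (B * B);
  con_relP : `[< congruence con_rel >] }.

HB.instance Definition _ (B : algebra) := [isSub for @con_rel B].
HB.instance Definition _ (B : algebra) := [Choice of Con B by <:].
HB.instance Definition _ (B : algebra) :=
  [SubChoice_isSubPOrder of Con B by <: with set_display].

Lemma Con_leE (B : algebra) (theta phi : Con B) :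
  (theta <= phi) = `[< subset theta phi >].
Proof. by []. Qed.

Reserved Notation "x =>> y" (at level 55, right associativity).

(* Classically every type carries a choiceType structure, so the one required *)
(* by tbLatticeType is no restriction on the algebras considered.             *)
HB.mixin Record TBLattice_isHeyting d (A : Type) of Order.TBLattice d A := {
  himp : A -> A -> A;
  meet_himp : forall x y : A, x `&` himp x y = x `&` y;
  meet_himp_distr : forall x y z : A,
    x `&` himp y z = x `&` himp (x `&` y) (x `&` z);
  himp_meetl : forall x y : A, himp (x `&` y) x = \top }.

#[short(type="heytingType")]
HB.structure Definition Heyting d :=
  { A of Order.TBLattice d A & TBLattice_isHeyting d A }.

Notation "x =>> y" := (himp x y) : order_scope.

HB.mixin Record Heyting_isMonadic d (A : Type) of Heyting d A := {
  mforall : A -> A;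
  mexists : A -> A;
  mforall_le : forall x : A, mforall x <= x;
  le_mexists : forall x : A, x <= mexists x;
  mforallI : forall x y : A, mforall (x `&` y) = mforall x `&` mforall y;
  mexistsU : forall x y : A, mexists (x `|` y) = mexists x `|` mexists y;
  mforall1 : mforall \top = \top;
  mexists0 : mexists \bot = \bot;
  mforall_mexists : forall x : A, mforall (mexists x) = mexists x;
  mexists_mforall : forall x : A, mexists (mforall x) = mforall x;
  mforall_himp : forall x y : A,
    mforall (x =>> y) <= (mexists x =>> mexists y) }.

#[short(type="monadicHeytingType")]
HB.structure Definition MonadicHeyting d :=
  { A of Heyting d A & Heyting_isMonadic d A }.

HB.mixin Record MonadicHeyting_isGodel d (A : Type) of MonadicHeyting d A := {
  himp_prelinear : forall x y : A, (x =>> y) `|` (y =>> x) = \top;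
  mforall_mexistsU : forall x y : A,
    mforall (mexists x `|` y) = mexists x `|` mforall y }.

#[short(type="monadicGodelType")]
HB.structure Definition MonadicGodel d :=
  { A of MonadicHeyting d A & MonadicHeyting_isGodel d A }.

Definition op0 (T : Type) (c : T) : ('I_0 -> T) -> T := fun=> c.
Definition op1 (T : Type) (f : T -> T) : ('I_1 -> T) -> T := fun u => f (u ord0).
Definition op2 (T : Type) (f : T -> T -> T) : ('I_2 -> T) -> T :=
  fun u => f (u ord0) (u ord_max).

Inductive godel_symbol := GJoin | GMeet | GImp | GForall | GExists | GBot | GTop.

Definition godel_arity (s : godel_symbol) : nat :=
  match s with
  | GJoin | GMeet | GImp => 2
  | GForall | GExists => 1
  | GBot | GTop => 0
  end.

Definition godel_interp d (G : monadicGodelType d) (s : godel_symbol) :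
    ('I_(godel_arity s) -> G) -> G :=
  match s with
  | GJoin => op2 (fun x y : G => x `|` y)
  | GMeet => op2 (fun x y : G => x `&` y)
  | GImp => op2 (fun x y : G => x =>> y)
  | GForall => op1 (fun x : G => mforall x)
  | GExists => op1 (fun x : G => mexists x)
  | GBot => op0 (\bot : G)
  | GTop => op0 (\top : G)
  end.

Definition godel_algebra d (G : monadicGodelType d) : algebra :=
  Algebra (@godel_interp d G).

Section HeytingTheory.
Context {d : Order.disp_t} {A : heytingType d}.
Implicit Types x y z : A.

Lemma le_himp x y z : x `&` y <= z -> x <= y =>> z.
Proof.
move=> xyz; rewrite leEmeet meet_himp_distr.
have xy_xz : x `&` y <= x `&` z by rewrite lexI leIl.
by rewrite -(meet_r xy_xz) himp_meetl meetx1.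
Qed.

Lemma himp_le x y z : x <= y =>> z -> x `&` y <= z.
Proof.
by move=> /(leI2 (lexx y)); rewrite meet_himp meetC => /le_trans; apply; exact: leIr.
Qed.

Lemma heyting_meetUl x y z : (x `|` y) `&` z = (x `&` z) `|` (y `&` z).
Proof.
apply/le_anti/andP; split.
  by apply: himp_le; rewrite leUx !le_himp ?leUl ?leUr.
by rewrite leUx !leI2 ?leUl ?leUr.
Qed.

End HeytingTheory.

Section K.
Context {d : Order.disp_t} (G : monadicGodelType d).

Record Kset := MkK { kval : G * G; _ : kval.1 `&` kval.2 = \bot }.

Implicit Types p q : Kset.

Lemma kvalP p : (kval p).1 `&` (kval p).2 = \bot.
Proof. by case: p. Qed.

Fact KjoinP p q :
  ((kval p).1 `|` (kval q).1) `&` ((kval p).2 `&` (kval q).2) = \bot.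
Proof.
rewrite heyting_meetUl meetA kvalP meet0x.
by rewrite [_ `&` (kval q).2]meetC meetA kvalP meet0x joinxx.
Qed.
Definition Kjoin p q : Kset := MkK (kval := (_, _)) (KjoinP p q).

Fact KmeetP p q :
  ((kval p).1 `&` (kval q).1) `&` ((kval p).2 `|` (kval q).2) = \bot.
Proof.
rewrite meetC heyting_meetUl meetA [(kval p).2 `&` _]meetC kvalP meet0x.
by rewrite meetCA [(kval q).2 `&` _]meetC kvalP meetx0 joinxx.
Qed.
Definition Kmeet p q : Kset := MkK (kval := (_, _)) (KmeetP p q).

Fact KimpP p q :
  ((kval p).1 =>> (kval q).1) `&` ((kval p).1 `&` (kval q).2) = \bot.
Proof.
rewrite meetA [_ `&` (kval p).1]meetC meet_himp.
by rewrite -meetA kvalP meetx0.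
Qed.
Definition Kimp p q : Kset := MkK (kval := (_, _)) (KimpP p q).

Fact KnegP p : (kval p).2 `&` (kval p).1 = \bot.
Proof. by rewrite meetC kvalP. Qed.
Definition Kneg p : Kset := MkK (kval := (_, _)) (KnegP p).

Fact KexistsP p : mexists (kval p).1 `&` mforall (kval p).2 = \bot.
Proof.
apply/le_anti; rewrite le0x andbT meetC; apply: himp_le.
rewrite -[X in _ =>> X]mexists0; apply: (le_trans _ (mforall_himp _ _)).
set b := (kval p).2; set c := _ =>> _.
have bc : b <= c by apply: le_himp; rewrite meetC kvalP.
by rewrite leEmeet -mforallI; move: bc; rewrite leEmeet => /eqP->.
Qed.
Definition Kexists p : Kset := MkK (kval := (_, _)) (KexistsP p).

Definition Kbot : Kset := MkK (kval := (\bot, \top)) (meet0x \top).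
Definition Ktop : Kset := MkK (kval := (\top, \bot)) (meetx0 \top).

Inductive Nc_symbol := NJoin | NMeet | NImp | NNeg | NExists | NBot | NTop.

Definition Nc_arity (s : Nc_symbol) : nat :=
  match s with
  | NJoin | NMeet | NImp => 2
  | NNeg | NExists => 1
  | NBot | NTop => 0
  end.

Definition K_interp (s : Nc_symbol) : ('I_(Nc_arity s) -> Kset) -> Kset :=
  match s with
  | NJoin => op2 Kjoin
  | NMeet => op2 Kmeet
  | NImp => op2 Kimp
  | NNeg => op1 Kneg
  | NExists => op1 Kexists
  | NBot => op0 Kbot
  | NTop => op0 Ktop
  end.

Definition K_algebra : algebra := Algebra K_interp.

Definition gamma (theta : set (G * G)) : set (Kset * Kset) :=
  [set pq | theta ((kval pq.1).1, (kval pq.2).1) /\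
            theta ((kval pq.1).2, (kval pq.2).2)]%classic.

End K.

(* Main.v *)
Require Import Defs.
From mathcomp Require Import all_boot all_order.
From mathcomp Require Import boolp classical_sets.

(** The inverse of [theta |-> gamma theta] sends a congruence [sigma] of [K G]
    to [{(x, y) | (x, 0) sigma (y, 0)}].  All elements of [K G] may occur as
    constants in congruence arguments, in particular the centre [(0, 0)]: the
    identities [(a, b) \/ (0, 0) = (a, 0)] and [~ (a, b) = (b, a)] show that
    [sigma] relates components, and [(a, b) = (a, 0) /\ ((b, 0) -> (0, 1))],
    valid because [a /\ b = 0], rebuilds a pair from its components.  The
    quantifier [forall], which is not an operation of [K G] on first components,
    is recovered from [(forall x, 0) = ~ exists_K ~ (x, 0)]. *)

Set Implicit Arguments.
Unset Strict Implicit.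
Unset Printing Implicit Defensive.

Import Order.TTheory.
Local Open Scope order_scope.

(** Compatibility is stated for families indexed by ['I_2]. Applying [op2 f] to [pair2 x y] computes
    to [f x y], which gives the binary congruence rules below in curried form. *)
Definition pair2 (T : Type) (x y : T) (i : 'I_2) : T :=
  if i == ord0 then x else y.

Lemma forall_pair2 (T : Type) (R : set (T * T)) (x y x' y' : T) :
  R (x, x') -> R (y, y') -> forall i, R (pair2 x y i, pair2 x' y' i).
Proof. by move=> Rx Ry i; rewrite /pair2; case: ifP. Qed.

Section KalmanTheory.
Context {d : Order.disp_t} {G : monadicGodelType d}.
Implicit Types (p q : Kset G) (a b x y : G).

(** Proofs of disjointness are irrelevant, so identities in [Kset G] can be checked componentwise in
    [G]. *)
Lemma kval_inj : injective (@kval d G).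
Proof.
move=> [u hu] [v hv] /= uv; rewrite -uv in hv *.
by congr MkK; exact: Prop_irrelevance.
Qed.

Lemma mforall0 : mforall (\bot : G) = \bot.
Proof. by apply/le_anti; rewrite mforall_le le0x. Qed.

Definition Kpos x : Kset G := MkK (kval := (x, \bot)) (meetx0 x).

Lemma Kpos_fst p : Kpos (kval p).1 = Kjoin p (Kpos \bot).
Proof. by apply: kval_inj; rewrite /= joinx0 meetx0. Qed.

Lemma Kpos_snd p : Kpos (kval p).2 = Kjoin (Kneg p) (Kpos \bot).
Proof. exact: (Kpos_fst (Kneg p)). Qed.

Lemma Kpos_meet_imp p :
  p = Kmeet (Kpos (kval p).1) (Kimp (Kpos (kval p).2) (Kbot G)).
Proof.
apply: kval_inj; case: p => -[a b] /= ab0; rewrite join0x meetx1; congr (_, _).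
(* Disjointness enters here: [a /\ b = 0] gives [a <= b =>> 0] by residuation, so meeting with
   [b =>> 0] leaves [a] unchanged. *)
by apply/esym/meet_l/le_himp; rewrite ab0.
Qed.

Lemma KposU x y : Kpos (x `|` y) = Kjoin (Kpos x) (Kpos y).
Proof. by apply: kval_inj; rewrite /= meetx0. Qed.

Lemma KposI x y : Kpos (x `&` y) = Kmeet (Kpos x) (Kpos y).
Proof. by apply: kval_inj; rewrite /= joinx0. Qed.

Lemma Kpos_himp x y : Kpos (x =>> y) = Kimp (Kpos x) (Kpos y).
Proof. by apply: kval_inj; rewrite /= meetx0. Qed.

Lemma Kpos_mexists x : Kpos (mexists x) = Kexists (Kpos x).
Proof. by apply: kval_inj; rewrite /= mforall0. Qed.

Lemma Kpos_mforall x : Kpos (mforall x) = Kneg (Kexists (Kneg (Kpos x))).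
Proof. by apply: kval_inj; rewrite /= mexists0. Qed.

Section CongruenceG.
Variable theta : set (G * G).
Hypothesis thetaP : congruence (B := godel_algebra G) theta.

Lemma cong_join a b x y :
  theta (a, x) -> theta (b, y) -> theta (a `|` b, x `|` y).
Proof. by move=> ax /(forall_pair2 ax)/(cong_compat thetaP (s := GJoin)). Qed.

Lemma cong_meet a b x y :
  theta (a, x) -> theta (b, y) -> theta (a `&` b, x `&` y).
Proof. by move=> ax /(forall_pair2 ax)/(cong_compat thetaP (s := GMeet)). Qed.

Lemma cong_himp a b x y :
  theta (a, x) -> theta (b, y) -> theta (a =>> b, x =>> y).
Proof. by move=> ax /(forall_pair2 ax)/(cong_compat thetaP (s := GImp)). Qed.

Lemma cong_mforall a x : theta (a, x) -> theta (mforall a, mforall x).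
Proof.
move=> ax.
exact: (cong_compat thetaP (s := GForall) (u := fun=> a) (v := fun=> x)).
Qed.

Lemma cong_mexists a x : theta (a, x) -> theta (mexists a, mexists x).
Proof.
move=> ax.
exact: (cong_compat thetaP (s := GExists) (u := fun=> a) (v := fun=> x)).
Qed.

(** Each component of an operation of [K_algebra G] is a term of [G] in the components of the
    arguments; second components use the dual operation, so [Kexists] needs compatibility with both
    quantifiers. *)
Lemma gamma_congruence : congruence (B := K_algebra G) (gamma theta).
Proof.
split.
- by move=> p; split; exact: (cong_refl thetaP).
- by move=> p q [pq1 pq2]; split; exact: (cong_sym thetaP).
- by move=> q p r [pq1 pq2] [qr1 qr2]; split;
    [exact: (cong_trans thetaP pq1)|exact: (cong_trans thetaP pq2)].
- case=> /= u v uv;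
    (* For the constants the index type ['I_0] is empty and both attempts fail harmlessly. *)
    try have [uv01 uv02] := uv ord0; try have [uvm1 uvm2] := uv ord_max.
  + by split; [exact: cong_join|exact: cong_meet].
  + by split; [exact: cong_meet|exact: cong_join].
  + by split; [exact: cong_himp|exact: cong_meet].
  + by split.
  + by split; [exact: cong_mexists|exact: cong_mforall].
  + by split; exact: (cong_refl thetaP).
  + by split; exact: (cong_refl thetaP).
Qed.

End CongruenceG.

Section CongruenceK.
Variable sigma : set (Kset G * Kset G).
Hypothesis sigmaP : congruence (B := K_algebra G) sigma.

Lemma cong_Kjoin p q p' q' :
  sigma (p, p') -> sigma (q, q') -> sigma (Kjoin p q, Kjoin p' q').
Proof. by move=> pp' /(forall_pair2 pp')/(cong_compat sigmaP (s := NJoin)). Qed.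

Lemma cong_Kmeet p q p' q' :
  sigma (p, p') -> sigma (q, q') -> sigma (Kmeet p q, Kmeet p' q').
Proof. by move=> pp' /(forall_pair2 pp')/(cong_compat sigmaP (s := NMeet)). Qed.

Lemma cong_Kimp p q p' q' :
  sigma (p, p') -> sigma (q, q') -> sigma (Kimp p q, Kimp p' q').
Proof. by move=> pp' /(forall_pair2 pp')/(cong_compat sigmaP (s := NImp)). Qed.

Lemma cong_Kneg p q : sigma (p, q) -> sigma (Kneg p, Kneg q).
Proof.
move=> pq.
exact: (cong_compat sigmaP (s := NNeg) (u := fun=> p) (v := fun=> q)).
Qed.

Lemma cong_Kexists p q : sigma (p, q) -> sigma (Kexists p, Kexists q).
Proof.
move=> pq.
exact: (cong_compat sigmaP (s := NExists) (u := fun=> p) (v := fun=> q)).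
Qed.

Definition Kpos_preimage : set (G * G) :=
  [set xy | sigma (Kpos xy.1, Kpos xy.2)]%classic.

(** [Kpos] turns each operation of [G] into a term of [K_algebra G], and congruences are compatible
    with terms. Constants need only reflexivity, although [Kpos \bot] is the centre and not a
    constant of [K_algebra G]. *)
Lemma Kpos_preimage_congruence :
  congruence (B := godel_algebra G) Kpos_preimage.
Proof.
rewrite /Kpos_preimage; split => /=.
- by move=> x; exact: (cong_refl sigmaP).
- by move=> x y; exact: (cong_sym sigmaP).
- by move=> y x z; exact: (cong_trans sigmaP).
- case=> /= u v uv.
  + by rewrite !KposU; apply: cong_Kjoin; exact: uv.
  + by rewrite !KposI; apply: cong_Kmeet; exact: uv.
  + by rewrite !Kpos_himp; apply: cong_Kimp; exact: uv.
  + rewrite !Kpos_mforall.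
    by apply/cong_Kneg/cong_Kexists/cong_Kneg; exact: uv.
  + by rewrite !Kpos_mexists; apply: cong_Kexists; exact: uv.
  + exact: (cong_refl sigmaP).
  + exact: (cong_refl sigmaP).
Qed.

(** This yields surjectivity: [sigma] is determined by its restriction to the image of [Kpos]. *)
Lemma gamma_Kpos_preimage : gamma Kpos_preimage = sigma.
Proof.
have refl p : sigma (p, p) by exact: (cong_refl sigmaP).
rewrite eqEsubset; split => -[p q]; rewrite /gamma /Kpos_preimage /=.
  move=> [pq1 pq2]; rewrite (Kpos_meet_imp p) (Kpos_meet_imp q).
  by apply: cong_Kmeet => //; exact: cong_Kimp.
move=> pq; rewrite !Kpos_fst !Kpos_snd.
by split; apply: cong_Kjoin => //; exact: cong_Kneg.
Qed.

End CongruenceK.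

(** This yields injectivity: the second components of [Kpos x] and [Kpos y] are both [\bot], hence
    related by reflexivity, and only the condition on [x] and [y] remains. *)
Lemma Kpos_preimage_gamma (theta : set (G * G)) :
  congruence (B := godel_algebra G) theta -> Kpos_preimage (gamma theta) = theta.
Proof.
move=> thetaP; rewrite eqEsubset; split => -[x y]; first by case.
by move=> xy; split => //; exact: (cong_refl thetaP).
Qed.

Lemma subset_gamma (theta phi : set (G * G)) :
  subset theta phi -> subset (gamma theta) (gamma phi).
Proof. by move=> le_tp pq [pq1 pq2]; split; exact: le_tp. Qed.

Lemma subset_Kpos_preimage (sigma tau : set (Kset G * Kset G)) :
  subset sigma tau -> subset (Kpos_preimage sigma) (Kpos_preimage tau).
Proof. by move=> le_st xy; exact: le_st. Qed.

Definition Con_gamma (theta : Con (godel_algebra G)) : Con (K_algebra G) :=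
  MkCon (asboolT (gamma_congruence (asboolW (con_relP theta)))).

Definition Con_Kpos_preimage (sigma : Con (K_algebra G)) :
    Con (godel_algebra G) :=
  MkCon (asboolT (Kpos_preimage_congruence (asboolW (con_relP sigma)))).

End KalmanTheory.

Theorem theorem4 (d : Order.disp_t) (G : monadicGodelType d) :
  exists f : Con (godel_algebra G) -> Con (K_algebra G),
    [/\ forall theta : Con (godel_algebra G), con_rel (f theta) = gamma (con_rel theta),
        bijective f
      & {mono f : theta phi / (theta <= phi)%O}].
Proof.
exists Con_gamma; split => //.
  exists Con_Kpos_preimage => [theta|sigma]; apply: val_inj => /=.
    exact: Kpos_preimage_gamma (asboolW (con_relP theta)).
  exact: gamma_Kpos_preimage (asboolW (con_relP sigma)).
move=> theta phi; rewrite !Con_leE; apply: asbool_equiv_eq; split.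
  (* The order is reflected because the inverse map is monotone too: apply it to both sides and
     cancel. *)
  move=> /subset_Kpos_preimage; rewrite /= !Kpos_preimage_gamma //.
  - exact: asboolW (con_relP phi).
  - exact: asboolW (con_relP theta).
exact: subset_gamma.
Qed.
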